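(* If $Y$ is a biquandle and $X$ is an abelian biquandle, then the set $\mathrm{Hom}(Y,X)$ of biquandle homomorphisms from $Y$ to $X$ has a biquandle structure, with biquandle map $B(f,g)=(g^f,f_g)$, defined by $$f^g(x)=f(x)^{g(x)}\quad\text{and}\quad g_f(x)=g(x)_{f(x)}$$ for all $f,g\in\mathrm{Hom}(Y,X)$ and $x\in Y$.
   Context: For a set $X$ let $\Delta:X\to X\times X$ be $\Delta(x)=(x,x)$. A biquandle map on $X$ is an invertible map $B:X\times X\to X\times X$, denoted $B(x,y)=(B_1(x,y),B_2(x,y))=(y^x,x_y)$, such that: (i) there exists a unique invertible map $S:X\times X\to X\times X$ (the sideways map) such that $S(B_1(x,y),x)=(B_2(x,y),y)$ for all $x,y\in X$; (ii) the component maps of $S\Delta$ satisfy $(S\Delta)_1=(S\Delta)_2:X\to X$, and this map is bijective; (iii) $B$ satisfies the set-theoretic Yang-Baxter equation $(B\times I)(I\times B)(B\times I)=(I\times B)(B\times I)(I\times B)$ on $X\times X\times X$, where $I$ is the identity map of $X$. A biquandle is a set $X$ with a choice of biquandle map $B$. A biquandle homomorphism $f:Y\to X$ is a map satisfying $f(y^x)=f(y)^{f(x)}$ and $f(x_y)=f(x)_{f(y)}$ for all $x,y\in Y$. A biquandle $X$ is abelian if for all $a,b,x,y\in X$: $$(b^a)^{y^x}=(b^y)^{a^x},\qquad (a_b)^{x_y}=(a^x)_{b^y},\qquad (x_y)_{a_b}=(x_a)_{y_b}.$$ *)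

(* Defs.v *)
From mathcomp Require Import all_boot.

Set Implicit Arguments.
Unset Strict Implicit.
Unset Printing Implicit Defensive.

(* B (x, y) = (y^x, x_y); hence [up B y x] is y^x (the first component, with
   the arguments swapped) and [dn B x y] is x_y (the second component). *)
Definition up (X : Type) (B : X * X -> X * X) (y x : X) : X := (B (x, y)).1.
Definition dn (X : Type) (B : X * X -> X * X) (x y : X) : X := (B (x, y)).2.

Definition sideways (X : Type) (B S : X * X -> X * X) : Prop :=
  bijective S /\ forall x y : X, S ((B (x, y)).1, x) = ((B (x, y)).2, y).

Definition map_id (X : Type) (B : X * X -> X * X) (t : X * X * X) : X * X * X :=
  (B t.1, t.2).
Definition id_map (X : Type) (B : X * X -> X * X) (t : X * X * X) : X * X * X :=
  (t.1.1, (B (t.1.2, t.2)).1, (B (t.1.2, t.2)).2).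

Definition yang_baxter (X : Type) (B : X * X -> X * X) : Prop :=
  map_id B \o id_map B \o map_id B =1 id_map B \o map_id B \o id_map B.

(* [unique P S] says that S satisfies P and equals every map satisfying P, so
   uniqueness of the sideways map is among the invertible maps. *)
Record is_biquandle_map (X : Type) (B : X * X -> X * X) : Prop :=
  IsBiquandleMap {
    biquandle_map_bij : bijective B;
    biquandle_map_sideways :
      exists S : X * X -> X * X,
        [/\ unique (sideways B) S,
            forall x : X, (S (x, x)).1 = (S (x, x)).2 &
            bijective (fun x : X => (S (x, x)).1)];
    biquandle_map_yang_baxter : yang_baxter B
  }.

Record biquandle : Type := Biquandle {
  biquandle_sort :> Type;
  bmap : biquandle_sort * biquandle_sort -> biquandle_sort * biquandle_sort;
  bmapP : is_biquandle_map bmap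
}.

Notation "y ^^ x" := (up (@bmap _) y x) (at level 29, left associativity).
Notation "x \_ y" := (dn (@bmap _) x y) (at level 29, left associativity).

Definition abelian_biquandle (X : biquandle) : Prop :=
  forall a b x y : X,
    [/\ (b ^^ a) ^^ (y ^^ x) = (b ^^ y) ^^ (a ^^ x),
        (a \_ b) ^^ (x \_ y) = (a ^^ x) \_ (b ^^ y) &
        (x \_ y) \_ (a \_ b) = (x \_ a) \_ (y \_ b)].

Record biquandle_hom (Y X : biquandle) : Type := BiquandleHom {
  hom_fun :> Y -> X;
  hom_up : forall x y : Y, hom_fun (y ^^ x) = hom_fun y ^^ hom_fun x;
  hom_dn : forall x y : Y, hom_fun (x \_ y) = hom_fun x \_ hom_fun y
}.

(* Main.v *)
Require Import Defs.
From mathcomp Require Import all_boot.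
From mathcomp Require Import boolp.

(** The abelian axioms say exactly that the biquandle map B of X is an
    endomorphism of the product algebra X * X, whose operations act
    componentwise ([preserves_bmap]).  An endomorphism of X * X turns a pair of
    homomorphisms Y -> X into another such pair by pointwise application
    ([lift]), and lifting respects composition and inverses.  So B, its inverse
    and the sideways map S lift to pairs of homomorphisms as soon as they are
    endomorphisms, and the equations among the biquandle axioms can be checked
    for the lifts at each point of Y.  Bijectivity of the diagonal map of S lifts in
    the same way ([lift_diag_bij]).  What remains is the uniqueness of the
    sideways map.

    Both that uniqueness and the fact that S is an endomorphism rest on the
    bijectivity of R (x, y) = (y^x, x).  The sideways equation reads S R = T
    with T (x, y) = (x_y, y); if R is bijective then S = T R^-1 is a composition
    of endomorphisms, and it is determined by the equation, on X and on
    homomorphisms alike.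

    Injectivity of R is immediate, but the uniqueness of S among invertible
    maps only yields at first that R misses at most one point ([miss_unique]):
    two missed points could be exchanged before applying S.  A single missed
    point is excluded by the Yang-Baxter equation together with the
    surjectivity of B ([side_src_surj]). *)

(** * The sideways map of a biquandle *)

Section Sideways.
Variables (X : biquandle) (S : X * X -> X * X).
Hypothesis S_unique : unique (sideways (@bmap X)) S.

Definition side_src (u : X * X) : X * X := (u.2 ^^ u.1, u.1).
Definition side_tgt (u : X * X) : X * X := (u.1 \_ u.2, u.2).

Lemma side_eq u : S (side_src u) = side_tgt u.
Proof. by case: S_unique => -[_ SE] _; case: u => x y; apply: SE. Qed.

Lemma up_inj x : injective (fun y : X => y ^^ x).
Proof.
move=> y y' /= e.
have: side_tgt (x, y) = side_tgt (x, y') by rewrite -!side_eq /side_src /= e.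
by case.
Qed.

Lemma dn_inj y : injective (fun x : X => x \_ y).
Proof.
have [[[S' SK _] _] _] := S_unique.
move=> x x' /= e.
have: side_src (x, y) = side_src (x', y).
  by apply: (can_inj SK); rewrite !side_eq /side_tgt /= e.
by case.
Qed.

Lemma up_up (x y z : X) : (z ^^ (x \_ y)) ^^ (y ^^ x) = (z ^^ y) ^^ x.
Proof.
have yb := biquandle_map_yang_baxter (bmapP X) (x, y, z).
by have := congr1 (fun t => t.1.1) yb.
Qed.

(** If two points were missed, exchanging them and then applying S would give
    a second invertible map satisfying the sideways equation. *)
Lemma miss_unique u v :
  (forall w, side_src w <> u) -> (forall w, side_src w <> v) -> u = v.
Proof.
have [[[S' SK S'K] SE] S_only] := S_unique.
move=> missu missv.
pose swap w := if pselect (w = u) then v else if pselect (w = v) then u else w.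
have swap_u : swap u = v by rewrite /swap; case: pselect.
have swap_v : swap v = u.
  by rewrite /swap; case: pselect => //= _; case: pselect.
have swap_id w : w <> u -> w <> v -> swap w = w.
  by rewrite /swap; case: pselect => //= _; case: pselect.
have swapK : involutive swap.
  move=> w; have [->|nu] := pselect (w = u); first by rewrite swap_u.
  have [->|nv] := pselect (w = v); first by rewrite swap_v.
  by rewrite !swap_id.
have swapS : S = S \o swap.
  apply: S_only; split.
    by exists (swap \o S') => w /=; rewrite ?SK ?swapK // S'K.
  move=> x y /=; rewrite swap_id; first exact: SE.
    exact: (missu (x, y)).
  exact: (missv (x, y)).
have := congr1 (fun F => F u) swapS; rewrite /= swap_u.
exact: (can_inj SK).
Qed.

(** Write U_x y for y^x, so that the Yang-Baxter equation contains
    U_(y^x) U_(x_y) = U_x U_y.  If (p, q) is missed, then U_q misses exactly p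
    and every other U_x is onto.  The injective map U_q U_q has a strictly
    smaller image than any U_x; if U_(q_q) were onto, then U_(q^q) would have
    the image of U_q U_q, so q_q = q.  Now let (p, q) = B (x, y); then x is not
    q.  If y = q, then x_q = q = q_q contradicts injectivity; otherwise U_x U_y
    is onto, hence so is U_(x_y) = U_q, because U_(y^x) is injective. *)
Lemma side_src_surj u : exists w, side_src w = u.
Proof.
apply: contrapT => nu.
have miss w : side_src w <> u by move=> e; apply: nu; exists w.
case: u miss {nu} => p q miss.
have missU y : y ^^ q <> p by move=> e; apply: (miss (q, y)); rewrite /side_src e.
have hitx x z : x <> q -> exists y : X, y ^^ x = z.
  move=> ne; apply: contrapT => ny; apply: ne.
  suff [] : (z, x) = (p, q) by [].
  by apply: miss_unique => // -[a y] [e ea]; apply: ny; exists y; rewrite -ea.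
have qq : q \_ q = q.
  apply: contrapT => nqq.
  (* U_(q_q) is onto, so U_(q^q) and U_q U_q have the same image. *)
  have outer t : exists s : X, t ^^ (q ^^ q) = (s ^^ q) ^^ q.
    by have [s <-] := hitx _ t nqq; exists s; apply: up_up.
  have [eqq|nqq'] := pselect (q ^^ q = q); last first.
    have [t tE] := hitx _ p nqq'; have [s] := outer t.
    by rewrite tE => /esym/missU.
  by have [s] := outer p; rewrite eqq => /up_inj/esym/missU.
have [B' _ B'K] := biquandle_map_bij (bmapP X).
case E : (B' (p, q)) => [x y].
have := B'K (p, q); rewrite E => BE.
have yx : y ^^ x = p by rewrite /up BE.
have xy : x \_ y = q by rewrite /dn BE.
have nx : x <> q by move=> xq; apply: (missU y); rewrite -xq.
have [yq|ny] := pselect (y = q).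
  by apply: nx; apply: (dn_inj q); rewrite qq -{1}yq.
(* A preimage s of U_p p under U_x U_y = U_p U_q has U_q s = p. *)
have [t tE] := hitx x (p ^^ p) nx; have [s sE] := hitx y t ny.
have := up_up x y s; rewrite sE tE xy yx => /up_inj.
exact: missU.
Qed.

Lemma side_src_bij : bijective side_src.
Proof.
have [R' R'K] := choice side_src_surj.
exists R' => // u; have := R'K (side_src u).
by case: (R' _) => x y; case: u => a b [/[swap] -> /up_inj ->].
Qed.

End Sideways.

(** * Endomorphisms of the square of an abelian biquandle *)

Section Preserves.
Variable X : biquandle.

Definition pair_up (u v : X * X) : X * X := (u.1 ^^ v.1, u.2 ^^ v.2).
Definition pair_dn (u v : X * X) : X * X := (u.1 \_ v.1, u.2 \_ v.2).

Definition preserves (C : X * X -> X * X) : Prop :=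
  {morph C : u v / pair_up u v} /\ {morph C : u v / pair_dn u v}.

Lemma preserves_can C D :
  cancel C D -> cancel D C -> preserves C -> preserves D.
Proof.
by move=> CK DK [Cup Cdn]; split=> u v; apply: (can_inj CK);
  rewrite ?Cup ?Cdn !DK.
Qed.

Hypothesis X_abelian : abelian_biquandle X.

Lemma preserves_bmap : preserves (@bmap X).
Proof.
have bmapE (u : X * X) : bmap u = (u.2 ^^ u.1, u.1 \_ u.2).
  by case: u => x y; apply: surjective_pairing.
split=> -[x y] [a b]; rewrite !bmapE /pair_up /pair_dn /=.
  by have [-> _ _] := X_abelian b y a x; have [_ -> _] := X_abelian x y a b.
by have [_ -> _] := X_abelian y b x a; have [_ _ ->] := X_abelian a b x y.
Qed.

Lemma preserves_side_src : preserves (@side_src X).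
Proof.
have [Bup Bdn] := preserves_bmap.
by split=> -[x y] [a b]; congr pair;
  [by have := congr1 fst (Bup (x, y) (a, b))
  |by have := congr1 fst (Bdn (x, y) (a, b))].
Qed.

Lemma preserves_side_tgt : preserves (@side_tgt X).
Proof.
have [Bup Bdn] := preserves_bmap.
by split=> -[x y] [a b]; congr pair;
  [by have := congr1 snd (Bup (x, y) (a, b))
  |by have := congr1 snd (Bdn (x, y) (a, b))].
Qed.

Lemma preserves_sideways S : unique (sideways (@bmap X)) S -> preserves S.
Proof.
move=> S_unique.
have [Rup Rdn] := preserves_side_src; have [Tup Tdn] := preserves_side_tgt.
by split=> u v; have [a <-] := side_src_surj X S S_unique u;
  have [b <-] := side_src_surj X S S_unique v;
  rewrite -?Rup -?Rdn !side_eq.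
Qed.

End Preserves.

(** * Lifting to homomorphisms *)

Section Lift.
Variables Y X : biquandle.
Local Notation Hom := (biquandle_hom Y X).

Lemma hom_ext (f g : Hom) : f =1 g -> f = g.
Proof.
case: f g => [f fup fdn] [g gup gdn] /= /funext fg.
case: g / fg gup gdn => gup gdn.
by rewrite (Prop_irrelevance fup gup) (Prop_irrelevance fdn gdn).
Qed.

Definition ev (x : Y) (p : Hom * Hom) : X * X := (p.1 x, p.2 x).

Lemma pair_hom_ext p q : (forall x, ev x p = ev x q) -> p = q.
Proof.
by case: p q => [f g] [f' g'] e; congr pair; apply: hom_ext => x; case: (e x).
Qed.

Lemma triple_hom_ext (t t' : Hom * Hom * Hom) :
  (forall x, [/\ t.1.1 x = t'.1.1 x, t.1.2 x = t'.1.2 x & t.2 x = t'.2 x]) ->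
  t = t'.
Proof.
case: t t' => [[f g] h] [[f' g'] h'] e.
by congr (_, _, _); apply: hom_ext => x; case: (e x).
Qed.

Lemma ev_up x y p : ev (x ^^ y) p = pair_up X (ev x p) (ev y p).
Proof. by rewrite /ev !hom_up. Qed.

Lemma ev_dn x y p : ev (x \_ y) p = pair_dn X (ev x p) (ev y p).
Proof. by rewrite /ev !hom_dn. Qed.

Section LiftMap.
Variables (C : X * X -> X * X) (C_pres : preserves X C) (p : Hom * Hom).

Lemma lift_up x y :
  C (ev (x ^^ y) p) = pair_up X (C (ev x p)) (C (ev y p)).
Proof. by rewrite ev_up (proj1 C_pres). Qed.

Lemma lift_dn x y :
  C (ev (x \_ y) p) = pair_dn X (C (ev x p)) (C (ev y p)).
Proof. by rewrite ev_dn (proj2 C_pres). Qed.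

Definition lift : Hom * Hom :=
  (@BiquandleHom Y X (fun x => (C (ev x p)).1)
     (fun x y => congr1 fst (lift_up y x)) (fun x y => congr1 fst (lift_dn x y)),
   @BiquandleHom Y X (fun x => (C (ev x p)).2)
     (fun x y => congr1 snd (lift_up y x)) (fun x y => congr1 snd (lift_dn x y))).

Lemma ev_lift x : ev x lift = C (ev x p).
Proof. by rewrite [RHS]surjective_pairing. Qed.

End LiftMap.

Lemma liftK C D (C_pres : preserves X C) (D_pres : preserves X D) :
  cancel C D -> cancel (lift C C_pres) (lift D D_pres).
Proof. by move=> CK p; apply: pair_hom_ext => x; rewrite !ev_lift CK. Qed.

Lemma lift_bij C (C_pres : preserves X C) :
  bijective C -> bijective (lift C C_pres).
Proof.
case=> D CK DK; have D_pres := preserves_can X C D CK DK C_pres.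
by exists (lift D D_pres); apply: liftK.
Qed.

(** With s x the first component of C (x, x), the map s * s on X * X preserves
    the operations, hence so does its inverse; the lift of that inverse,
    restricted to the diagonal, inverts the map on homomorphisms. *)
Lemma lift_diag_bij C (C_pres : preserves X C) :
  bijective (fun x : X => (C (x, x)).1) ->
  bijective (fun f : Hom => (lift C C_pres (f, f)).1).
Proof.
case=> t sK tK.
pose s2 (u : X * X) := ((C (u.1, u.1)).1, (C (u.2, u.2)).1).
pose t2 (u : X * X) := (t u.1, t u.2).
have s2_pres : preserves X s2.
  have [Cup Cdn] := C_pres.
  split=> -[x y] [a b]; congr pair.
  - by have := congr1 fst (Cup (x, x) (a, a)).
  - by have := congr1 fst (Cup (y, y) (b, b)).
  - by have := congr1 fst (Cdn (x, x) (a, a)).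
  - by have := congr1 fst (Cdn (y, y) (b, b)).
have s2K : cancel s2 t2 by case=> x y; congr pair; apply: sK.
have t2K : cancel t2 s2 by case=> x y; congr pair; apply: tK.
have t2_pres := preserves_can X _ _ s2K t2K s2_pres.
exists (fun f => (lift t2 t2_pres (f, f)).1) => f; apply: hom_ext => x.
  exact: sK.
exact: tK.
Qed.

(** Existence is the equation S R = T at each point of Y.  For uniqueness a
    pointwise argument is not available, since a competitor S' need not be a
    lift; but R lifts to a bijection, so S' R = T leaves no choice for S'. *)
Lemma lift_sideways_unique S (X_abelian : abelian_biquandle X)
    (S_unique : unique (sideways (@bmap X)) S) (S_pres : preserves X S) :
  unique (sideways (lift (@bmap X) (preserves_bmap X X_abelian)))
         (lift S S_pres).
Proof.
set B := lift _ _.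
have [[S_bij SE] _] := S_unique.
have R_pres := preserves_side_src X X_abelian.
have [R' _ R'K] := lift_bij _ R_pres (side_src_bij X S S_unique).
have liftSE f g : lift S S_pres ((B (f, g)).1, f) = ((B (f, g)).2, g).
  by apply: pair_hom_ext => x; rewrite ev_lift; apply: SE.
split=> [|S' [_ S'E]]; first by split=> //; apply: lift_bij.
apply: funext => p; rewrite -(R'K p); case: (R' p) => f g.
have -> : lift _ R_pres (f, g) = ((B (f, g)).1, f) by apply: pair_hom_ext.
by rewrite liftSE S'E.
Qed.

Lemma lift_yang_baxter C (C_pres : preserves X C) :
  yang_baxter C -> yang_baxter (lift C C_pres).
Proof.
move=> yb [[f g] h].
apply: triple_hom_ext => x; have e := yb (f x, g x, h x).
split; first by have := congr1 (fun t => t.1.1) e.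
  by have := congr1 (fun t => t.1.2) e.
by have := congr1 snd e.
Qed.

End Lift.

Theorem proposition11 (Y X : biquandle) (X_abelian : abelian_biquandle X) :
  exists B : biquandle_hom Y X * biquandle_hom Y X ->
             biquandle_hom Y X * biquandle_hom Y X,
    is_biquandle_map B /\
    forall (f g : biquandle_hom Y X) (x : Y),
      up B f g x = f x ^^ g x /\ dn B g f x = g x \_ f x.
Proof.
exists (lift Y X (@bmap X) (preserves_bmap X X_abelian)); split=> //.
have [B_bij [S [S_unique S_diag S_diag_bij]] B_yb] := bmapP X.
have S_pres := preserves_sideways X X_abelian S S_unique.
split; [exact: lift_bij | exists (lift Y X S S_pres) | exact: lift_yang_baxter].
split; first exact: lift_sideways_unique.
- by move=> f; apply: hom_ext => x; apply: S_diag.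
- exact: lift_diag_bij.
Qed.
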